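(* Let $\xi_0,\xi_1,\ldots$ be i.i.d. nondegenerate complex-valued random variables such that $\bar F(t):=\mathbb{P}[\log|\xi_0|>t]$ is slowly varying at $+\infty$. Let $\mathcal{Z}_n$ be the collection of complex roots, counted with multiplicities, of $G_n(z)=\sum_{k=0}^n\xi_kz^k$. Then, as $n\to\infty$, the empirical measure $\frac1n\sum_{z\in\mathcal{Z}_n}\delta(z)$ converges weakly, as a random measure on the Riemann sphere $\bar{\mathbb{C}}=\mathbb{C}\cup\{\infty\}$, to $U\delta(0)+(1-U)\delta(\infty)$, where $U$ is a random variable with the uniform distribution on $[0,1]$.
   Context: $\delta(x)$ is the unit point mass at $x$; $\log0=-\infty$. If $G_n\equiv0$ (an event of probability tending to $0$), $\mathcal{Z}_n$ is taken to be empty. Convergence of random measures: for a locally compact metric space $E$, let $\mathbb{M}(E)$ be the space of locally finite Borel measures on $E$ with the vague topology; random measures $\mu_n$ on $E$ converge weakly to $\mu$ if $\mathbb{E}F(\mu_n)\to\mathbb{E}F(\mu)$ for every bounded continuous $F:\mathbb{M}(E)\to\mathbb{R}$; equivalently, $\int_E f\,d\mu_n\to\int_E f\,d\mu$ in distribution for every compactly supported continuous $f:E\to\mathbb{R}$. *)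

(* Defs.v *)
From HB Require Import structures.
From mathcomp Require Import all_boot all_order all_algebra.
From mathcomp Require Import complex.
From mathcomp Require Import all_classical all_reals all_analysis.

Set Implicit Arguments.
Unset Strict Implicit.
Unset Printing Implicit Defensive.

Import Order.TTheory GRing.Theory Num.Theory.
Import numFieldNormedType.Exports.

Local Open Scope classical_set_scope.
Local Open Scope ring_scope.

(* R[i] carries no topology in the library: give it the one of its norm. *)
#[warnings="-redundant-canonical-projection"]
HB.instance Definition _ (R : rcfType) := NormedModule.copy R[i] (R[i])^o.

Definition borel (E : ptopologicalType) := g_sigma_algebraType (@open E).

Section locally_finite_measures.
Context (E : ptopologicalType) (R : realType).

Definition locally_finite (mu : set (borel E) -> \bar R) : Prop :=
  forall x : E, exists U : set E, [/\ open U, U x & (mu U < +oo)%E].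

Lemma finite_locally_finite (mu : set (borel E) -> \bar R) :
  (mu setT < +oo)%E -> locally_finite mu.
Proof. by move=> muT x; exists setT; split => //; exact: openT. Qed.

Record lfmeasure := LFMeasure {
  lf_measure :> {measure set (borel E) -> \bar R} ;
  lf_measureP : locally_finite lf_measure }.

Record cfun := CFun {
  cfun_val :> E -> R ;
  cfun_continuous : continuous cfun_val ;
  cfun_compact : compact (closure [set x | cfun_val x != 0]) }.

HB.instance Definition _ := gen_eqMixin cfun.
HB.instance Definition _ := gen_choiceMixin cfun.

Definition vague_eval (mu : lfmeasure) : prod_topology (fun _ : cfun => R) :=
  fun f => (\int[mu]_(x in [set: borel E]) (f x))%R.

HB.instance Definition _ := gen_eqMixin lfmeasure.
HB.instance Definition _ := gen_choiceMixin lfmeasure.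
(* The vague topology: the coarsest one making mu |-> \int f dmu continuous for
   every compactly supported continuous f. *)
HB.instance Definition _ :=
  Topological.copy lfmeasure (initial_topology vague_eval).

End locally_finite_measures.
Arguments lfmeasure : clear implicits.

(* Weak convergence of random measures; the limit may live on another
   probability space. The expectation is total: mu_ n and mu are meant to be
   random measures, that is, measurable for the Borel sets of the vague
   topology, so that F \o mu_ n and F \o mu are random variables. *)
Definition random_measure_cvg (E : ptopologicalType) (R : realType)
    d (T : measurableType d) (P : probability T R)
    d' (T' : measurableType d') (Q : probability T' R)
    (mu_ : nat -> T -> lfmeasure E R) (mu : T' -> lfmeasure E R) : Prop :=
  forall F : lfmeasure E R -> R,
    continuous F -> (exists C : R, forall m, `|F m| <= C) ->
    ('E_P[F \o mu_ n])%E @[n --> \oo] --> ('E_Q[F \o mu])%E.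

Section random_variables.
Context d (T : measurableType d) (R : realType) (P : probability T R).
Context d' (T' : measurableType d').

Definition independent_RVs (X : nat -> {RV P >-> T'}) : Prop :=
  forall (s : seq nat) (A : nat -> set T'), uniq s ->
    (forall k, measurable (A k)) ->
    P (\big[setI/setT]_(k <- s) (X k @^-1` A k)) =
    (\prod_(k <- s) P (X k @^-1` A k))%E.

Definition identically_distributed (X : nat -> {RV P >-> T'}) : Prop :=
  forall (k : nat) (A : set T'), measurable A ->
    distribution P (X k) A = distribution P (X 0) A.

Definition nondegenerate_RV (X : {RV P >-> T'}) : Prop :=
  forall c : T', P (X @^-1` [set c]) != 1%E.

End random_variables.

(* As x / 0 = 0 in R, the limit 1 forces L to be eventually nonzero. *)
Definition slowly_varying (R : realType) (L : R -> R) : Prop :=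
  forall lambda : R, 0 < lambda -> L (lambda * t) / L t @[t --> +oo] --> (1 : R).

(* lne 0 = -oo *)
Definition log_tail (R : realType) d (T : measurableType d)
    (P : probability T R) (X : {RV P >-> borel R[i]}) (t : R) : R :=
  fine (P [set w | (t%:E < lne (Normc.normc (X w))%:E)%E]).

Section roots.
Context (R : realType).
Implicit Types (p : {poly R[i]}).

(* The list of the z in p = lead_coef p *: \prod_z ('X - z%:P), that is, the
   complex roots of p repeated according to their multiplicities. *)
Definition complex_roots p : seq R[i] :=
  if p == 0 then [::] else sval (closed_field_poly_normal p).

Lemma complex_rootsP p : p != 0 ->
  p = lead_coef p *: \prod_(z <- complex_roots p) ('X - z%:P).
Proof.
move=> p0; rewrite /complex_roots (negbTE p0).
by case: closed_field_poly_normal.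
Qed.

End roots.

(* The Riemann sphere: None is the point at infinity. *)
Notation sphere R := (one_point_compactification R[i]).

Section sphere_measures.
Context (R : realType).
Local Notation M := (lfmeasure (sphere R) R).

Definition point_mass (x : sphere R) :
    {measure set (borel (sphere R)) -> \bar R} :=
  dirac (x : borel (sphere R)).

Definition empirical_measure (n : nat) (s : seq R[i]) :
    {measure set (borel (sphere R)) -> \bar R} :=
  mscale (n%:R^-1)%:nng
    (msum (fun k => point_mass (Some (nth 0 s k))) (size s)).

Lemma empirical_measure_locally_finite n s :
  locally_finite (empirical_measure n s).
Proof.
apply: finite_locally_finite.
have -> : empirical_measure n s setT =
    ((n%:R^-1 : R)%:E * \sum_(k < size s) 1%:E)%E.
  by congr (_ * _)%E; apply: eq_bigr => k _; exact: diracT.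
by rewrite sumEFin -EFinM ltry.
Qed.

Definition root_measure n s : M :=
  LFMeasure (@empirical_measure_locally_finite n s).

(* u \delta(0) + (1 - u) \delta(oo) for u in [0, 1]; the absolute values make
   the weights nonnegative, hence the measure defined, for every u. *)
Definition zero_infty_measure (u : R) : {measure set (borel (sphere R)) -> \bar R} :=
  measure_add (mscale (`|u|)%:nng (point_mass (Some 0)))
              (mscale (`|1 - u|)%:nng (point_mass None)).

Lemma zero_infty_measure_locally_finite u : locally_finite (zero_infty_measure u).
Proof.
apply: finite_locally_finite.
have -> : zero_infty_measure u setT = (`|u|%:E * 1%:E + `|1 - u|%:E * 1%:E)%E.
  by rewrite [LHS]measure_addE; congr (_ * _ + _ * _)%E; exact: diracT.
by rewrite -!EFinM -EFinD ltry.
Qed.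

Definition zero_infty_mix (u : R) : M := LFMeasure (zero_infty_measure_locally_finite u).

End sphere_measures.

(* Main.v *)
Require Import Defs.
From mathcomp Require Import all_boot all_order all_algebra.
From mathcomp Require Import complex.
From mathcomp Require Import ring lra zify.
From mathcomp Require Import all_classical all_reals all_analysis.
From mathcomp Require Import measurable_realfun.
Import Order.TTheory GRing.Theory Num.Theory.
Import numFieldNormedType.Exports.
Local Open Scope classical_set_scope.
Local Open Scope ring_scope.

Set Implicit Arguments.
Unset Strict Implicit.
Unset Printing Implicit Defensive.

(** The tail of log|xi_0| is so heavy that, with probability tending to 1, a single
    coefficient xi_m dwarfs all the others: |xi_m| > exp ((n + 1)^2) |xi_k| for every
    k <> m. By exchangeability, the index m is then uniform on 0, ..., n.

    On this event the polynomial behaves like the monomial xi_m z^m as long as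
    1 / (4 (n + 1)) <= |z| <= 4 (n + 1). It has no root in this annulus
    ([root_outside_annulus]), exactly m roots inside, and the others outside. The
    count is obtained by algebra alone ([count_roots_dominant_coef]): a
    product of factors attached to very small and very large roots is nearly a
    monomial, whose degree is the number of small roots, and which must be the
    monomial carrying the dominant coefficient. With high probability only a bounded
    number of leading coefficients can vanish, so the empirical measure is close to
    (m / n) delta_0 + (1 - m / n) delta_oo, and m / n is nearly uniform.

    The probability of domination is computed on the scales |xi| ~ exp (2 ^ j). If
    a j is the probability of exceeding the scale j, slow variation says that
    a j.+1 / a j tends to 1. The coefficient m dominates on the scale j with
    probability (a j.+1 - a j.+2) (1 - a j)^n, the sum over j compares with a
    telescoping sum, and n + 1 times it tends to 1 ([dominant_prob_near1]). Slow
    variation also ensures that the relevant scales satisfy 2 ^ j >= (n + 1)^2.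

    Finally, a test functional F, continuous for the vague topology, is uniformly
    continuous near the compact curve of the mixes u delta_0 + (1 - u) delta_oo
    ([near_mix_uniform]), so the expectations of F at the empirical measures and
    at the mix of U are both close to the average over m of F at the mix of m / n
    ([expectations_close]). *)

(** * Polynomials with a dominant coefficient *)

Section roots.
Context (K : numFieldType).
Implicit Types (p q : {poly K}) (s : seq K) (delta z : K).

(** Truncating the sum at a free bound M keeps multiplication by 'X norm-decreasing
    without any bookkeeping of degrees. *)
Definition coef_norm1 M p := \sum_(i < M) `|p`_i|.

Lemma coef_norm1D M p q : coef_norm1 M (p + q) <= coef_norm1 M p + coef_norm1 M q.
Proof.
rewrite /coef_norm1 -big_split/=; apply: ler_sum => i _.
by rewrite coefD ler_normD.
Qed.

Lemma coef_norm1Z M z p : coef_norm1 M (z *: p) = `|z| * coef_norm1 M p.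
Proof.
rewrite /coef_norm1 mulr_sumr; apply: eq_bigr => i _.
by rewrite coefZ normrM.
Qed.

Lemma coef_norm1MX M p : coef_norm1 M (p * 'X) <= coef_norm1 M p.
Proof.
rewrite /coef_norm1; case: M => [|M]; first by rewrite !big_ord0.
rewrite big_ord_recl coefMX/= normr0 add0r big_ord_recr/=.
rewrite -[leLHS]addr0 lerD// le_eqVlt; apply/orP; left; apply/eqP.
by apply: eq_bigr => i _; rewrite coefMX.
Qed.

Lemma coef_norm1Xn M j : coef_norm1 M 'X^j <= 1.
Proof.
rewrite /coef_norm1; under eq_bigr do rewrite coefXn.
have [jM|Mj] := ltnP j M.
  rewrite (bigD1 (Ordinal jM))//= eqxx normr1 big1 ?addr0// => i ij.
  by move: ij; rewrite -val_eqE/= => /negbTE ->; rewrite normr0.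
rewrite big1// => i _; rewrite ltn_eqF ?normr0//.
exact: leq_trans (ltn_ord i) Mj.
Qed.

(** Write the factor of a small root z as 'X - z, and the factor of a large root
    as a scalar times 1 - z^-1 'X. Every factor is then at distance at most delta
    from a monomial, 'X or 1, and distances compound multiplicatively: if q is at
    distance e from 'X^j then the next product is at distance at most
    (1 + e) (1 + delta) - 1. *)
Lemma prod_XsubC_near_Xn delta s : 0 < delta ->
  {in s, forall z, `|z| < delta \/ delta^-1 < `|z|} ->
  exists c q, \prod_(z <- s) ('X - z%:P) = c *: q /\
    forall M, coef_norm1 M (q - 'X^(count (fun z => `|z| < delta) s))
              <= (1 + delta) ^+ size s - 1.
Proof.
move=> d0; elim: s => [|z s IHs] sP.
  exists 1, 1; rewrite big_nil scale1r; split => // M.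
  rewrite /= expr0 !subrr /coef_norm1 big1// => i _.
  by rewrite coef0 normr0.
have [x xs|c [q [pE qM]]] := IHs; first by apply: sP; rewrite inE xs orbT.
rewrite big_cons pE /=; set j := count _ s in qM *.
have q1 M : coef_norm1 M q <= (1 + delta) ^+ size s.
  have := le_trans (coef_norm1D M (q - 'X^j) 'X^j)
    (lerD (qM M) (coef_norm1Xn M j)).
  by rewrite !subrK.
have step M t r : coef_norm1 M t <= (1 + delta) ^+ size s - 1 ->
    coef_norm1 M r <= delta * (1 + delta) ^+ size s ->
    coef_norm1 M (t + r) <= (1 + delta) ^+ (size s).+1 - 1.
  move=> tM rM; apply: le_trans (coef_norm1D _ _ _) _.
  apply: le_trans (lerD tM rM) _; rewrite exprS le_eqVlt; apply/orP; left.
  by apply/eqP; ring.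
have [zd|/negbTE zd] := boolP (`|z| < delta).
  exists c, (q * ('X - z%:P)); split; first by rewrite mulrC scalerAl.
  move=> M; rewrite add1n exprSr.
  have -> : q * ('X - z%:P) - 'X^j * 'X = (q - 'X^j) * 'X + (- z) *: q.
    by rewrite -mul_polyC polyCN; ring.
  apply: step; first exact: le_trans (coef_norm1MX _ _) (qM M).
  rewrite coef_norm1Z normrN ler_pM ?sumr_ge0//; exact: ltW.
have zd' : delta^-1 < `|z| by case: (sP z (mem_head _ _)); rewrite ?zd.
have z0 : z != 0 by rewrite -normr_gt0 (lt_trans _ zd') ?invr_gt0.
exists (- z * c), (q * (1 - z^-1 *: 'X)); split.
  rewrite -!mul_polyC polyCM polyCN.
  have : z%:P * (z^-1)%:P = 1 :> {poly K} by rewrite -polyCM divff.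
  by set Z := z%:P; set Z' := (z^-1)%:P => ZZ; rewrite -(mul1r 'X) -{1}ZZ; ring: ZZ.
move=> M; rewrite add0n.
have -> : q * (1 - z^-1 *: 'X) - 'X^j = (q - 'X^j) + (- z^-1) *: (q * 'X).
  by rewrite -!mul_polyC polyCN; ring.
apply: step; first exact: qM.
rewrite coef_norm1Z normrN normfV ler_pM ?invr_ge0 ?sumr_ge0//.
  by rewrite invf_ple ?posrE ?normr_gt0// ltW.
exact: le_trans (coef_norm1MX _ _) (q1 M).
Qed.

(** The normalised product q is at distance less than 1/2 from 'X^j, where j is the
    number of small roots, so its j-th coefficient exceeds 1/2 and all the others
    are below 1/2: the position of the largest coefficient reveals j. This
    replaces an appeal to the theorem of Rouché. *)
Lemma count_roots_dominant_coef delta s c m : 0 < delta ->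
  (1 + delta) ^+ size s *+ 2 < 3 -> c != 0 ->
  {in s, forall z, `|z| < delta \/ delta^-1 < `|z|} ->
  let p := c *: \prod_(z <- s) ('X - z%:P) in
  (forall k, k != m -> `|p`_k| < `|p`_m|) ->
  count (fun z => `|z| < delta) s = m.
Proof.
move=> d0 small c0 sP p pm; apply/eqP/negPn/negP => jm.
have [b [q [qE qM]]] := prod_XsubC_near_Xn d0 sP.
set j := count _ s in jm qM.
have {}qM k : `|q`_k - (k == j)%:R| *+ 2 < 1.
  apply: (@le_lt_trans _ _ (((1 + delta) ^+ size s - 1) *+ 2)); last first.
    by rewrite mulrnBl ltrBlDr; apply: lt_le_trans small _; rewrite nat1r.
  rewrite lerMn2r/=.
  apply: le_trans (qM k.+1); rewrite /coef_norm1 big_ord_recr/= coefB coefXn.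
  by rewrite lerDr sumr_ge0.
have /= := pm _ jm; rewrite /p qE scalerA !coefZ !normrM => /lt_le_trans.
move=> /(_ (`|c| * `|b| * `|q`_j|)) H.
suff: `|q`_m| <= `|q`_j|.
  by move=> /(ler_wpM2l (mulr_ge0 (normr_ge0 c) (normr_ge0 b)))/H; rewrite ltxx.
have := qM m; rewrite [m == j]eq_sym (negbTE jm) subr0 => qm.
have := qM j; rewrite eqxx => qj; have := ler_normB q`_j (q`_j - 1).
rewrite opprB addrC subrK normr1 => qj'.
have {}qj' : 1 <= `|q`_j| + `|q`_j - 1| by [].
have : 1 *+ 2 < `|q`_j| *+ 2 + 1.
  apply: le_lt_trans (_ : (`|q`_j| + `|q`_j - 1|) *+ 2 < _).
    by rewrite lerMn2r.
  by rewrite mulrnDl ltrD2l.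
rewrite mulr2n ltrD2r => q1.
by rewrite -(ler_pMn2r (n := 2))// ltW// (lt_trans qm).
Qed.

(** In the annulus delta <= |z| <= delta^-1 the powers |z|^k and |z|^m differ at
    most by a factor delta^-n, so the m-th term of p(z) beats the sum of the
    others and p(z) cannot vanish. *)
Lemma root_outside_annulus delta p n m z : 0 < delta -> delta <= 1 ->
  (size p <= n.+1)%N -> (m <= n)%N ->
  \sum_(k < n.+1 | k != m :> nat) delta ^- n * `|p`_k| < `|p`_m| ->
  root p z -> `|z| < delta \/ delta^-1 < `|z|.
Proof.
move=> d0 d1 pn mn pm /rootP pz.
have [zd|dz] := boolP (`|z| < delta); [by left|right].
rewrite real_ltNge ?realV ?normr_real ?(gtr0_real d0)//; apply/negP => zd'.
move: dz; rewrite -real_leNgt ?normr_real ?(gtr0_real d0)// => dz.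
have z0 : 0 < `|z| by exact: lt_le_trans dz.
move: pz; rewrite (horner_coef_wide z pn) (bigD1 (Ordinal (mn : (m < n.+1)%N)))//=.
move=> /eqP; rewrite addr_eq0 => /eqP/(congr1 Num.norm).
rewrite normrN normrM normrX => pz.
suff: `|p`_m| * `|z| ^+ m < `|p`_m| * `|z| ^+ m by rewrite ltxx.
rewrite {1}pz; apply: le_lt_trans (ler_norm_sum _ _ _) _.
rewrite -ltr_pdivrMr ?exprn_gt0//; apply: le_lt_trans pm.
rewrite mulr_suml ler_sum// => k _.
rewrite normrM normrX -mulrA mulrC ler_wpM2r//.
rewrite ler_pdivrMr ?exprn_gt0//.
have d1' : 1 <= delta^-1 by rewrite invf_ge1.
have [km|mk] := leqP k m.
  rewrite -(subnKC km) exprD mulrCA ler_peMr ?exprn_ge0//.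
  apply: (@le_trans _ _ (delta ^- (m - k) * delta ^+ (m - k))).
    by rewrite mulVf// expf_neq0// gt_eqF.
  rewrite ler_pM ?exprn_ge0 ?invr_ge0 ?exprn_ge0 ?(ltW d0)//.
    by rewrite -!exprVn ler_weXn2l// (leq_trans (leq_subr _ _)).
  by rewrite lerXn2r// ?nnegrE ?(ltW d0).
rewrite -(subnKC (ltnW mk)) exprD mulrC ler_wpM2r ?exprn_ge0//.
apply: (@le_trans _ _ (delta^-1 ^+ (k - m))).
  by rewrite lerXn2r// nnegrE ?invr_ge0 ?(ltW d0).
by rewrite -exprVn ler_weXn2l// (leq_trans (leq_subr _ _))// -ltnS.
Qed.

(** With delta = 1 / (4 (n + 1)) the compounded distance (1 + delta)^(n+1) - 1 is at
    most 1/3, while the annulus free of roots still exhausts the punctured plane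
    as n grows. *)
Lemma dominant_coef_roots n p s m : (m <= n)%N -> (size p <= n.+1)%N ->
  p = lead_coef p *: \prod_(z <- s) ('X - z%:P) -> p`_m != 0 ->
  (forall k, (k <= n)%N -> k != m ->
     (4 * n.+1)%:R ^+ n.+1 * `|p`_k| < `|p`_m|) ->
  [/\ {in s, forall z, `|z| < (4 * n.+1)%:R^-1 \/ (4 * n.+1)%:R < `|z|},
      count (fun z => `|z| < (4 * n.+1)%:R^-1) s = m,
      (m <= size s)%N & size s = (size p).-1].
Proof.
move=> mn pn pE pm0 pm; set N : K := (4 * n.+1)%:R in pm *.
have N0 : 0 < N by rewrite ltr0n.
have N1 : 1 <= N by rewrite ler1n.
have p0 : p != 0 by apply: contraNneq pm0 => ->; rewrite coef0.
have c0 : lead_coef p != 0 by rewrite lead_coef_eq0.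
have ss : size s = (size p).-1.
  by rewrite pE size_scale// size_prod_XsubC.
have sep : {in s, forall z, `|z| < N^-1 \/ N^-1^-1 < `|z|}.
  move=> z zs; apply: (@root_outside_annulus _ p n m).
  - by rewrite invr_gt0.
  - by rewrite invf_le1.
  - by [].
  - by [].
  - rewrite -exprVn invrK.
    apply: (@le_lt_trans _ _ (\sum_(k < n.+1 | k != m :> nat) N^-1 * `|p`_m|)).
      apply: ler_sum => k km; rewrite ler_pdivlMl// mulrA -exprS.
      by rewrite ltW// pm// -ltnS.
    apply: (@le_lt_trans _ _ (\sum_(k < n.+1) N^-1 * `|p`_m|)).
      by rewrite big_mkcond ler_sum// => k _; case: ifP; rewrite // mulr_ge0 ?invr_ge0 ?(ltW N0).
    rewrite sumr_const card_ord -mulr_natl mulrA gtr_pMl ?normr_gt0//.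
    by rewrite -/N ltr_pdivrMr// mul1r ltr_nat -[ltnLHS]mul1n ltn_pmul2r.
  - by rewrite pE rootZ// root_prod_XsubC.
have count_m : count (fun z => `|z| < N^-1) s = m.
  apply: (@count_roots_dominant_coef _ s (lead_coef p)) => //.
  - by rewrite invr_gt0.
  - have NV0 : 0 < N^-1 by rewrite invr_gt0.
    have NV : N^-1 * n.+1%:R = 1 / 4.
      by rewrite /N natrM invfM mulfVK ?pnatr_eq0 ?div1r.
    (* Bernoulli for 1 - delta: it bounds (1 + delta)^N by 1 / (1 - N delta) = 4/3 *)
    have bern k : 1 - k%:R * N^-1 <= (1 - N^-1) ^+ k.
      elim: k => [|k IHk]; first by rewrite mul0r subr0.
      rewrite exprS -natr1; apply: le_trans (ler_wpM2l _ IHk).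
        rewrite -subr_ge0.
        have -> : (1 - N^-1) * (1 - k%:R / N) - (1 - (k%:R + 1) / N) = k%:R * N^-1 ^+ 2 by ring.
        by rewrite mulr_ge0 ?exprn_ge0 ?(ltW NV0).
      by rewrite subr_ge0 invf_le1.
    have sn : (size s <= n.+1)%N by rewrite ss (leq_trans (leq_pred _)).
    apply: (@le_lt_trans _ _ ((1 + N^-1) ^+ n.+1 *+ 2)).
      by rewrite lerMn2r/= ler_weXn2l// lerDl ltW.
    have t34 : (1 + N^-1) ^+ n.+1 * (3 / 4) <= 1.
      apply: (@le_trans _ _ ((1 + N^-1) ^+ n.+1 * (1 - N^-1) ^+ n.+1)).
        rewrite ler_wpM2l ?exprn_ge0 ?addr_ge0 ?(ltW NV0)//.
        apply: le_trans (bern _); rewrite [n.+1%:R * _]mulrC NV.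
        by rewrite le_eqVlt; apply/orP; left; apply/eqP; field.
      rewrite -exprMn -[leRHS](expr1n _ n.+1) lerXn2r ?nnegrE//.
        by rewrite mulr_ge0 ?subr_ge0 ?invf_le1// addr_ge0 ?(ltW NV0).
      have -> : (1 + N^-1) * (1 - N^-1) = 1 - N^-1 ^+ 2 by ring.
      by rewrite gerBl exprn_ge0// ltW.
    move: t34; set t := _ ^+ _ => t34.
    have t3 : t * 3 <= 4.
      by rewrite -[leRHS]mul1r -ler_pdivrMr ?ltr0n// -mulrA.
    rewrite -(ltr_pM2r (_ : 0 < 3 :> K))//; apply: (@le_lt_trans _ _ (4 * 2)).
      by rewrite -mulr_natr mulrAC ler_wpM2r.
    by rewrite -!natrM ltr_nat.
  - rewrite -pE => k km; have [kn|nk] := leqP k n; last first.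
      by rewrite nth_default ?normr0 ?normr_gt0// (leq_trans pn).
    apply: le_lt_trans (pm _ kn km).
    by rewrite ler_peMl// exprn_ege1.
split => //; first by move=> z /sep; rewrite invrK.
by rewrite -{1}count_m count_size.
Qed.

End roots.

(** * Slowly decreasing sequences *)

Section tails.
Context (R : realType) (a : nat -> R).
Context (a_gt0 : forall j, 0 < a j) (a_le1 : forall j, a j <= 1).
Context (a_noninc : forall j, a j.+1 <= a j).
Context (a_slow : forall e, 0 < e ->
  \forall j \near \oo, a j <= (1 + e) * a j.+1).
Context (a_cvg0 : a @ \oo --> 0).

(** Consecutive terms of a have ratio tending to 1, so a decays more slowly than any
    geometric sequence: here 2^l wins against two steps of a. *)
Lemma pow2_tail_large C :
  \forall l \near \oo, C <= 2 ^+ l * a l.*2.+3.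
Proof.
have [J _ aJ] := a_slow (ltac:(lra) : 0 < 1 / 10).
pose u l := 2 ^+ l * a l.*2.+3.
have uS l : (J <= l)%N -> 3 / 2 * u l <= u l.+1.
  move=> Jl; rewrite /u doubleS exprS.
  have /= h1 := aJ l.*2.+3 (ltac:(simpl; lia)).
  have /= h2 := aJ l.*2.+4 (ltac:(simpl; lia)).
  have p2 : 0 < 2 ^+ l :> R by rewrite exprn_gt0.
  have : a l.*2.+3 <= 121 / 100 * a l.*2.+4.+1 by lra.
  rewrite -(ler_pM2l p2) => H; move: (a_gt0 l.*2.+4.+1) => a0.
  have : 0 < 2 ^+ l * a l.*2.+4.+1 by rewrite mulr_gt0.
  by move: H; move: (2 ^+ l) => p; lra.
have u0 l : 0 < u l by rewrite mulr_gt0// exprn_gt0.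
have ugrow k : (1 + k%:R / 2) * u J <= u (J + k)%N.
  elim: k => [|k IHk]; first by rewrite addn0 mul0r addr0 mul1r.
  rewrite addnS; apply: le_trans (uS _ (leq_addr _ _)).
  apply: le_trans (ler_wpM2l _ IHk); last by lra.
  rewrite [leRHS]mulrA ler_wpM2r ?(ltW (u0 J))// -natr1.
  have : 0 <= k%:R :> R by []. lra.
near=> l.
have Jl : (J <= l)%N by near: l; exact: nbhs_infty_ge.
rewrite -/(u l) -(subnKC Jl); apply: le_trans (ugrow _).
rewrite -ler_pdivrMr//; apply: (@le_trans _ _ ((l - J)%:R / 2)); last by lra.
rewrite ler_pdivlMr//.
rewrite natrB// lerBrDr; near: l; exact: nbhs_infty_ger.
Unshelve. all: by end_near. Qed.

(** The critical scale j + 1 of n + 1 trials is the last one at which the expected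
    number of exceedances is still at least C. The previous lemma makes it so large
    that 2^j >= (n + 1)^2. *)
Lemma scale_exists C J : 0 < C -> \forall n \near \oo, exists j,
  [/\ (J <= j)%N, (n.+1 ^ 2 <= 2 ^ j)%N, C <= n.+1%:R * a j.+1
    & n.+1%:R * a j.+2 < C].
Proof.
move=> C0; have [l0 _ large] := pow2_tail_large C.
near=> n; pose l := trunc_log 2 n.+1.
have /andP[ln nl] : (2 ^ l <= n.+1 < 2 ^ l.+1)%N by exact: trunc_log_bounds.
have l0l : (maxn J l0 <= l)%N.
  apply: trunc_log_max => //; apply: (@leq_trans n) => //.
  by near: n; exact: nbhs_infty_ge.
have C_l : C <= n.+1%:R * a l.*2.+3.
  apply: le_trans (large l _) _ => /=; first by rewrite (leq_trans (leq_maxr J l0)).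
  by rewrite ler_wpM2r ?(ltW (a_gt0 _))// -natrX ler_nat.
have [j1 aj1] : exists j1, forall j, (j1 <= j)%N -> n.+1%:R * a j < C.
  have /cvgrPdist_lt/(_ (C / n.+1%:R)) [|j1 _ H] := a_cvg0.
    by rewrite divr_gt0.
  exists j1 => j /H; rewrite sub0r normrN (gtr0_norm (a_gt0 j)).
  by rewrite ltr_pdivlMr// mulrC.
have [||j /= jP jmax] := @ex_maxnP (fun j => (l.*2.+2 <= j)%N && (C <= n.+1%:R * a j.+1)) j1.
- by exists l.*2.+2; rewrite leqnn.
- move=> j /andP[_]; apply: contraTT; rewrite -ltnNge -ltNge => j1j.
  by apply: aj1; rewrite ltnW// ltnS ltnW.
move/andP : jP => [lj Cj]; exists j; split => //.
- by move: l0l; rewrite geq_max => /andP[Jl _]; rewrite (leq_trans _ lj)//; lia.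
- apply: (@leq_trans ((2 ^ l.+1) ^ 2)); first by rewrite leq_exp2r// ltnW.
  by rewrite -expnM leq_exp2l//; lia.
- rewrite ltNge; apply/negP => Cj1.
  have /jmax : (l.*2.+2 <= j.+1)%N && (C <= n.+1%:R * a j.+2).
    by rewrite Cj1 (leq_trans lj).
  by rewrite ltnn.
Unshelve. all: by end_near. Qed.

Lemma subrX_le (x y : R) n : 0 <= x -> x <= y -> y <= 1 ->
  y ^+ n - x ^+ n <= n%:R * (y - x).
Proof.
move=> x0 xy y1; elim: n => [|n IHn]; first by rewrite mul0r subrr.
have y0 : 0 <= y by exact: le_trans xy.
have -> : y ^+ n.+1 - x ^+ n.+1 = y * (y ^+ n - x ^+ n) + x ^+ n * (y - x).
  by rewrite !exprS; ring.
rewrite -natr1 mulrDl mul1r lerD//.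
  apply: le_trans IHn; rewrite ler_piMl// subr_ge0 lerXn2r//.
by rewrite ler_piMl ?subr_ge0// exprn_ile1// (le_trans xy).
Qed.

Lemma pow_1B_le (x : R) n : 0 <= x -> x <= 1 -> (1 - x) ^+ n * (1 + n%:R * x) <= 1.
Proof.
move=> x0 x1; apply: (@le_trans _ _ ((1 - x) ^+ n * (1 + x) ^+ n)).
  rewrite ler_wpM2l ?exprn_ge0 ?subr_ge0//.
  elim: n => [|n IHn]; first by rewrite mul0r addr0.
  rewrite exprS -natr1.
  apply: le_trans (ler_wpM2l _ IHn); last by lra.
  have : 0 <= n%:R * x ^+ 2 by rewrite mulr_ge0// exprn_ge0.
  lra.
rewrite -exprMn exprn_ile1//; first by rewrite mulr_ge0; lra.
have : 0 <= x ^+ 2 by rewrite exprn_ge0.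
lra.
Qed.

(** When a j is the probability that one trial exceeds the scale j, the (j+1)-st
    summand is the probability that a given trial lies on the scale j + 1 while
    the n others stay below the scale j. Up to replacing a j by a j.+2 in the last
    factor, the sum dominates a telescoping sum of (1 - a j)^(n+1), which runs from
    nearly 0 at the critical scale to nearly 1. The replacement costs at most a
    constant times e ((n + 1) a j0)^2, where e bounds the relative variation of a,
    and (n + 1) a j0 stays bounded by choice of j0. *)
Lemma dominant_prob_near1 eta : 0 < eta -> \forall n \near \oo, exists j0 L,
  (n.+1 ^ 2 <= 2 ^ j0)%N /\
  1 - eta <= n.+1%:R * \sum_(j0 <= j < L) (a j.+1 - a j.+2) * (1 - a j) ^+ n.
Proof.
move=> eta0; pose C := 3 / eta; pose e := Num.min (1 / 10) (eta / (36 * C ^+ 2)).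
have C0 : 0 < C by rewrite divr_gt0.
have e0 : 0 < e by rewrite lt_min !divr_gt0// mulr_gt0// exprn_gt0.
have e1 : e <= 1 / 10 by rewrite ge_min lexx.
have eC : e * (36 * C ^+ 2) <= eta.
  have D0 : 0 < 36 * C ^+ 2 by rewrite mulr_gt0// exprn_gt0.
  by rewrite -ler_pdivlMr// /e ge_min lexx orbT.
have [J _ aJ] := a_slow e0.
have a_homo i j : (i <= j)%N -> a j <= a i.
  by move=> ij; apply: (nonincreasing_seqP _).1.
have [n0 _ scale] := scale_exists J C0.
exists n0 => // n /scale[j0 [Jj0 nj0 Cj0 Cj0']] /=.
set N := n.+1%:R in Cj0 Cj0' *.
have N0 : 0 < N by rewrite ltr0n.
have [L [j0L aL]] : exists L, (j0 <= L)%N /\ N * a L.+1 <= eta / 3.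
  have /cvgrPdist_lt/(_ (eta / 3 / N)) [|j1 _ H] := a_cvg0.
    by rewrite !divr_gt0.
  exists (maxn j0 j1); split; first exact: leq_maxl.
  rewrite mulrC -ler_pdivlMr//; have /= := H (maxn j0 j1).+1.
  rewrite (leq_trans (leq_maxr j0 j1))// sub0r normrN gtr0_norm// => /(_ isT).
  exact: ltW.
exists j0, L; split => //.
have two j : (j0 <= j)%N -> a j - a j.+2 <= 3 * e * a j0.
  move=> j0j.
  have /= h1 := aJ j (leq_trans Jj0 j0j).
  have /= h2 := aJ j.+1 (leq_trans (leq_trans Jj0 j0j) (leqnSn _)).
  have h3 : (1 + e) * a j.+1 <= (1 + e) * ((1 + e) * a j.+2) by rewrite ler_wpM2l// ; lra.
  have : a j.+2 <= a j0 by apply: a_homo; rewrite (leq_trans j0j)// ltnW.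
  have := a_gt0 j.+2; have : 0 <= e * a j.+2 by rewrite mulr_ge0 ?ltW.
  move=> h4 h5; rewrite -(ler_pM2l e0) => h6.
  have h7 : e * (e * a j.+2) <= 1 / 10 * (e * a j.+2) by rewrite ler_wpM2r.
  have : 0 <= e * a j0 by rewrite mulr_ge0 ?ltW.
  lra.
have Nj0 : N * a j0 <= 2 * C.
  have := two j0 (leqnn _); have := a_gt0 j0 => a0 h.
  have : 3 * e * a j0 <= 3 / 10 * a j0 by rewrite ler_wpM2r ?(ltW a0)//; lra.
  move=> h'; have : a j0 <= 2 * a j0.+2 by lra.
  by rewrite -(ler_pM2l N0); lra.
(* the last term is the price of replacing a j.+2 by a j in the powers *)
have tele : (1 - a L.+1) ^+ n.+1 - (1 - a j0.+1) ^+ n.+1 <=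
    N * (\sum_(j0 <= j < L) (a j.+1 - a j.+2) * (1 - a j) ^+ n) +
    N * (\sum_(j0 <= j < L) (a j.+1 - a j.+2)) * (N * (3 * e * a j0)).
  rewrite -(telescope_sumr (fun j => (1 - a j.+1) ^+ n.+1)) //.
  rewrite mulr_sumr [N * \sum_(_ <= _ < _) _]mulr_sumr mulr_suml -big_split/=.
  rewrite big_nat_cond [leRHS]big_nat_cond; apply: ler_sum => j /andP[/andP[j0j jL] _].
  have d0 : 0 <= a j.+1 - a j.+2 by rewrite subr_ge0.
  apply: (@le_trans _ _ (N * (a j.+1 - a j.+2) * (1 - a j.+2) ^+ n)).
    have b0 : 0 <= 1 - a j.+1 by rewrite subr_ge0.
    have -> : a j.+1 - a j.+2 = (1 - a j.+2) - (1 - a j.+1) by ring.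
    have : 1 - a j.+1 <= 1 - a j.+2 by rewrite lerB.
    have : 1 - a j.+2 <= 1 by rewrite gerBl ltW.
    move: b0; move: (1 - a j.+1) (1 - a j.+2) => x y x0 y1 xy.
    rewrite subrXX mulrC [leRHS]mulrAC ler_wpM2r ?subr_ge0//.
    rewrite mulrC /N -[n.+1 in leRHS]card_ord mulr_natr -sumr_const.
    apply: ler_sum => i _ /=.
    apply: (@le_trans _ _ (y ^+ (n - i) * y ^+ i)).
      by rewrite ler_wpM2l ?exprn_ge0 ?lerXn2r ?nnegrE ?(le_trans x0).
    by rewrite -exprD subnK// -ltnS.
  have xy : (1 - a j.+2) ^+ n <= (1 - a j) ^+ n + N * (3 * e * a j0).
    rewrite -lerBlDl; apply: le_trans (subrX_le _ _ _ _) _.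
    - by rewrite subr_ge0.
    - by rewrite lerB// a_homo// ltnW.
    - by rewrite gerBl ltW.
    - have -> : 1 - a j.+2 - (1 - a j) = a j - a j.+2 by ring.
      rewrite ler_pM ?subr_ge0 ?ler_nat ?two// a_homo// ltnW//.
  have := ler_wpM2l (mulr_ge0 (ltW N0) d0) xy; lra.
have sum_le : \sum_(j0 <= j < L) (a j.+1 - a j.+2) <= a j0.
  have -> : \sum_(j0 <= j < L) (a j.+1 - a j.+2) = a j0.+1 - a L.+1.
    rewrite -[RHS]opprB -(telescope_sumr (fun j => a j.+1))// -sumrN.
    by apply: eq_bigr => j _; rewrite opprB.
  by have := a_noninc j0; have := a_gt0 L.+1; lra.
have err : N * (\sum_(j0 <= j < L) (a j.+1 - a j.+2)) * (N * (3 * e * a j0)) <= eta / 3.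
  apply: (@le_trans _ _ (N * a j0 * (N * (3 * e * a j0)))).
    rewrite ler_wpM2r ?ler_wpM2l ?(ltW N0)//.
    by rewrite !mulr_ge0// ltW.
  have x0 : 0 <= N * a j0 by rewrite mulr_ge0 ?ltW.
  have -> : N * a j0 * (N * (3 * e * a j0)) = 3 * e * (N * a j0) ^+ 2 by ring.
  apply: (@le_trans _ _ (3 * e * (2 * C) ^+ 2)); last by lra.
  by rewrite ler_wpM2l ?mulr_ge0 ?(ltW e0)// lerXn2r ?nnegrE// mulr_ge0 ?ltW.
have hi : 1 - eta / 3 <= (1 - a L.+1) ^+ n.+1.
  have := @subrX_le (1 - a L.+1) 1 n.+1; rewrite subr_ge0 gerBl (ltW (a_gt0 _)) a_le1.
  move=> /(_ isT isT (lexx _)); rewrite expr1n opprB addrCA subrr addr0 -/N; lra.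
have lo : (1 - a j0.+1) ^+ n.+1 <= eta / 3.
  have := @pow_1B_le (a j0.+1) n.+1 (ltW (a_gt0 _)) (a_le1 _).
  set t := _ ^+ _ => h; have t0 : 0 <= t by rewrite exprn_ge0 ?subr_ge0.
  have : t * C <= 1.
    by apply: le_trans h; rewrite ler_wpM2l// -/N; lra.
  by rewrite -ler_pdivlMr// /C invf_div mul1r.
lra.
Qed.

End tails.

(** * Expectations enclosed between step functions *)

Section sandwich.
Context d (T : measurableType d) (R : realType).

(** The integral of a nonnegative function is a supremum over the simple functions
    below it, and such a supremum is monotone for arbitrary functions. *)
Lemma integral_mono (mu : {measure set T -> \bar R}) (f g : T -> \bar R) :
  (forall x, (f x <= g x)%E) -> (\int[mu]_x f x <= \int[mu]_x g x)%E.
Proof.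
move=> fg; rewrite [leLHS]integralE [leRHS]integralE.
have ge0_mono (u v : T -> \bar R) : (forall x, (0 <= u x)%E) ->
    (forall x, (u x <= v x)%E) -> (\int[mu]_x u x <= \int[mu]_x v x)%E.
  move=> u0 uv.
  rewrite [leLHS]ge0_integralTE// ge0_integralTE; last first.
    by move=> x; exact: le_trans (uv x).
  apply: le_ereal_sup => _ [h hu <-]; exists h => // x.
  exact: le_trans (hu x) (uv x).
apply: leeB; apply: ge0_mono => x; rewrite ?funepos_ge0 ?funeneg_ge0//.
  by apply: (@funepos_le _ _ setT) => //; rewrite inE.
by apply: (@funeneg_le _ _ setT) => //; rewrite inE.
Qed.

Context (P : probability T R).
Local Notation pr A := (fine (P A)).

Lemma fine_probabilityE A : measurable A -> P A = (pr A)%:E.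
Proof. by move=> mA; rewrite fineK// fin_num_measure. Qed.

Lemma integral_step (I : Type) (r : seq I) (A : I -> set T) (c : I -> R) :
  (forall i, measurable (A i)) ->
  (\int[P]_x (\sum_(i <- r) c i * \1_(A i) x)%:E =
   (\sum_(i <- r) c i * pr (A i))%:E)%E.
Proof.
move=> mA; under eq_integral do rewrite -sumEFin.
rewrite (integral_sum measurableT (f := fun i x => (c i * \1_(A i) x)%:E)).
  rewrite -sumEFin; apply: eq_bigr => i _.
  under eq_integral do rewrite EFinM.
  rewrite integralZl//; last exact: integrable_indic.
  by rewrite integral_indic// setIT EFinM -fine_probabilityE.
move=> i; under eq_fun do rewrite EFinM.
by apply: integrableZl => //; exact: integrable_indic.
Qed.

Section disjoint_events.
Context (I : eqType) (r : seq I) (A : I -> set T).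
Context (uniq_r : uniq r) (mA : forall i, measurable (A i)).
Context (A_disjoint :
  forall i j w, i \in r -> j \in r -> A i w -> A j w -> i = j).

Lemma sum_indic_in (f : I -> R) i w : i \in r -> A i w ->
  \sum_(k <- r) f k * \1_(A k) w = f i.
Proof.
move=> ir Aiw; rewrite (bigD1_seq i)//= big_seq_cond big1 ?addr0.
  by rewrite indicE mem_set// mulr1.
move=> j /andP[jr ji]; rewrite indicE memNset ?mulr0// => Ajw.
by move/eqP: ji; apply; exact: A_disjoint Aiw.
Qed.

Lemma sum_indic_out (f : I -> R) w : (forall i, i \in r -> ~ A i w) ->
  \sum_(k <- r) f k * \1_(A k) w = 0.
Proof.
by move=> nA; rewrite big_seq big1// => i /nA ?; rewrite indicE memNset// mulr0.
Qed.

Lemma sum_pr_le1 : \sum_(i <- r) pr (A i) <= 1.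
Proof.
rewrite -lee_fin.
have -> : \sum_(i <- r) pr (A i) = \sum_(i <- r) 1 * pr (A i).
  by apply: eq_bigr => i _; rewrite mul1r.
rewrite -integral_step//.
apply: (@le_trans _ _ (\int[P]_x (cst 1%E x))%E).
  apply: integral_mono => w; rewrite lee_fin.
  have [[i [ir Aiw]]|noA] := pselect (exists i, i \in r /\ A i w).
    by rewrite (sum_indic_in (fun=> 1) ir Aiw).
  by rewrite (sum_indic_out (fun=> 1))// => i ir Aiw; apply: noA; exists i.
by rewrite integral_cst// mul1e probability_le1.
Qed.

(** On A i, outside H, the function g is within e of the constant c i; elsewhere it
    is only known to be bounded. Two step functions thus enclose g, and monotonicity
    of the integral encloses its expectation. Enclosing g instead of approximating it
    spares any study of the roots as functions of the coefficients. *)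
Lemma expectation_sandwich (H : set T) (c : I -> R) (g : T -> R) (C e : R) :
  measurable H -> 0 <= e -> (forall w, `|g w| <= C) -> (forall i, `|c i| <= C) ->
  (forall i w, i \in r -> A i w -> ~ H w -> `|g w - c i| <= e) ->
  exists2 x : R, ('E_P[g] = x%:E)%E &
    `|x - \sum_(i <- r) c i * pr (A i)| <=
      e + C * (1 - \sum_(i <- r) pr (A i)) + 2 * C * pr H.
Proof.
move=> mH e0 gC cC gc.
have H01 w : 0 <= (\1_H w : R) <= 1.
  by rewrite indicE; case: (_ \in _); rewrite ?lexx ler01.
pose err w := e + C * (1 - \sum_(i <- r) \1_(A i) w) + 2 * C * \1_H w.
have close w : `|g w - \sum_(i <- r) c i * \1_(A i) w| <= err w.
  have C0 : 0 <= C by apply: le_trans (gC w).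
  have Hw := H01 w; rewrite /err.
  have -> : \sum_(i <- r) \1_(A i) w = \sum_(i <- r) 1 * \1_(A i) w :> R.
    by apply: eq_bigr => i _; rewrite mul1r.
  have [[i [ir Aiw]]|noA] := pselect (exists i, i \in r /\ A i w); last first.
    have out i : i \in r -> ~ A i w by move=> ir Aiw; apply: noA; exists i.
    rewrite !sum_indic_out// !subr0 mulr1.
    have := gC w; have : 0 <= 2 * C * \1_H w by rewrite !mulr_ge0//; lra.
    lra.
  rewrite !(sum_indic_in _ ir Aiw) subrr mulr0 addr0 indicE.
  have [Hw'|nH] := pselect (H w).
    rewrite mem_set// mulr1; apply: le_trans (ler_normB _ _) _.
    have := gC w; have := cC i; lra.
  by rewrite memNset// mulr0 addr0; exact: gc.
(* the enclosing step functions live on the whole space (None), H (Some None)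
   and the A i; k = 1 gives the upper one and k = -1 the lower one *)
pose B (o : option (option I)) := if o is Some (Some i) then A i else
  if o is Some None then H else setT.
have mB o : measurable (B o) by case: o => [[i|]|] /=.
pose s := None :: Some None :: [seq Some (Some i) | i <- r].
pose v (k : R) (o : option (option I)) := if o is Some (Some i) then c i - k * C else
  if o is Some None then k * (2 * C) else k * (e + C).
have vE k (f : I -> R) :
    \sum_(i <- r) (c i - k * C) * f i =
    \sum_(i <- r) c i * f i - k * C * \sum_(i <- r) f i.
  by rewrite mulr_sumr -sumrB; apply: eq_bigr => i _; rewrite mulrBl.
have intE k : (\int[P]_x (\sum_(i <- r) c i * \1_(A i) x + k * err x)%:E =
    (\sum_(i <- r) c i * pr (A i) +
     k * (e + C * (1 - \sum_(i <- r) pr (A i)) + 2 * C * pr H))%:E)%E.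
  transitivity (\int[P]_x (\sum_(o <- s) v k o * \1_(B o) x)%:E)%E.
    apply: eq_integral => x _; congr EFin.
    by rewrite /s !big_cons big_map/= vE indicT /err/=; ring.
  rewrite integral_step//; congr EFin.
  by rewrite /s !big_cons big_map/= vE probability_setT/=; ring.
have Eg : ('E_P[g] = \int[P]_x (g x)%:E)%E by rewrite unlock.
have lo : ((\sum_(i <- r) c i * pr (A i) +
     (-1) * (e + C * (1 - \sum_(i <- r) pr (A i)) + 2 * C * pr H))%:E <= 'E_P[g])%E.
  rewrite Eg -intE; apply: integral_mono => x; rewrite lee_fin.
  by have := close x; rewrite ler_norml; lra.
have hi : ('E_P[g] <= (\sum_(i <- r) c i * pr (A i) +
     1 * (e + C * (1 - \sum_(i <- r) pr (A i)) + 2 * C * pr H))%:E)%E.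
  rewrite Eg -intE; apply: integral_mono => x; rewrite lee_fin.
  by have := close x; rewrite ler_norml; lra.
move: lo hi; case: ('E_P[g])%E => //= x; rewrite !lee_fin => lo hi.
by exists x => //; rewrite ler_norml; lra.
Qed.

End disjoint_events.

End sandwich.

(** * The vague topology and mixes of two point masses on the sphere *)

Section vague_topology.
Context (E : ptopologicalType) (R : realType).

Lemma continuous_borel_measurable (f : E -> R) : continuous f ->
  measurable_fun [set: borel E] (f : borel E -> R).
Proof.
move=> /continuousP cf.
apply: (measurability _ (RGenOpens.measurableE R)).
move=> _ [_ [a [b ->] <-]]; rewrite setTI; apply: sub_sigma_algebra.
exact/cf/interval_open.
Qed.

(** The vague topology is initial for a map into a product, so convergence can be
    tested on one function f at a time. *)
Lemma vague_cvg (F : set_system (lfmeasure E R)) (mu : lfmeasure E R) :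
  Filter F -> (forall f, vague_eval x f @[x --> F] --> vague_eval mu f) ->
  F --> mu.
Proof.
move=> FF H.
have cv : (@vague_eval E R) @ F --> vague_eval mu.
  have FF' : Filter ((@vague_eval E R) @ F) by exact: fmap_filter.
  have [_] := @cvg_sup _ _ (fun f : cfun E R => Topological.class
    (initial_topology (fun g : cfun E R -> R => g f))) _ (vague_eval mu) FF'.
  apply => f A [_ [[B oB <-] Bf BA]].
  have FB : F [set x | B (vague_eval x f)] := H f B (open_nbhs_nbhs (conj oB Bf)).
  have : F ((@vague_eval E R) @^-1` A) by apply: filterS FB => x ?; exact: BA.
  by [].
move=> A [_ [[B oB <-] Bf BA]].
have FB : F [set x | B (vague_eval x)] := cv B (open_nbhs_nbhs (conj oB Bf)).
by apply: filterS FB => x ?; exact: BA.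
Qed.

End vague_topology.

(** The integrals of the positive and of the negative part reduce the real integral
    to the formula for nonnegative functions, the natural one for sums and
    multiples of measures. *)
Lemma Rintegral_atoms d (T : measurableType d) (R : realType)
    (mu : {measure set T -> \bar R}) (I : Type) (r : seq I) (w : I -> R) (x : I -> T)
    (f : T -> R) :
  (forall g : T -> \bar R, (forall y, 0 <= g y)%E -> measurable_fun setT g ->
    (\int[mu]_y g y = \sum_(i <- r) (w i)%:E * g (x i))%E) ->
  measurable_fun setT f ->
  (\int[mu]_y f y)%R = \sum_(i <- r) w i * f (x i).
Proof.
move=> muE mf; have mEf : measurable_fun setT (EFin \o f) by exact/measurable_EFinP.
rewrite /Rintegral integralE.
rewrite (muE _ (fun y => funepos_ge0 _ y) (measurable_funepos mEf)).
rewrite (muE _ (fun y => funeneg_ge0 _ y) (measurable_funeneg mEf)).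
under eq_bigr do rewrite funeposE/= -EFin_max -EFinM.
under [X in (_ - X)%E]eq_bigr do rewrite funenegE/= -EFin_max -EFinM.
rewrite !sumEFin/= -sumrB; apply: eq_bigr => i _; rewrite -mulrBr; congr (_ * _).
rewrite /Num.max; case: (ltP (f (x i)) 0) => h; case: (ltP (- f (x i)) 0) => h'; lra.
Qed.

Section vague_integrals.
Context (R : realType).
Implicit Types (f : cfun (sphere R) R).

Lemma vague_eval_root n (s : seq R[i]) f :
  vague_eval (root_measure n s) f = n%:R^-1 * \sum_(z <- s) f (Some z).
Proof.
rewrite mulr_sumr; apply: (@Rintegral_atoms _ _ _ (root_measure n s) _ s
  (fun=> n%:R^-1) (fun z => Some z : borel (sphere R))).
  move=> g g0 mg; rewrite ge0_integral_mscale// ge0_integral_measure_sum//.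
  rewrite (big_nth 0) big_mkord -ge0_sume_distrr//; congr (_ * _)%E.
  by apply: eq_bigr => i _; rewrite integral_dirac// diracT mul1e.
exact: (continuous_borel_measurable (@cfun_continuous _ _ f)).
Qed.

Lemma vague_eval_mix u f : 
  vague_eval (zero_infty_mix u) f = `|u| * f (Some 0) + `|1 - u| * f None.
Proof.
have -> : `|u| * f (Some 0) + `|1 - u| * f None =
    \sum_(b <- [:: true; false]) (if b then `|u| else `|1 - u|) *
      f (if b then Some 0 else None).
  by rewrite !big_cons big_nil addr0.
apply: (@Rintegral_atoms _ _ _ (zero_infty_mix u) _ _ (fun b : bool => _)
  (fun b : bool => (if b then Some 0 else None) : borel (sphere R))).
  move=> g g0 mg; rewrite ge0_integral_measure_add// !ge0_integral_mscale//.
  by rewrite !integral_dirac// !diracT !mul1e !big_cons big_nil adde0.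
exact: (continuous_borel_measurable (@cfun_continuous _ _ f)).
Qed.

End vague_integrals.
Section sphere_neighbourhoods.
Context (R : realType).

Lemma complex_near_infty_ger (x : R[i]) : 0 <= x -> \forall n \near \oo, x <= n%:R.
Proof.
case: x => a b; rewrite lecE/= => /andP[/eqP -> a0].
apply: filterS (nbhs_infty_ger a) => n an.
by rewrite -(rmorph_nat (real_complex R)) lecR.
Qed.

Lemma cfun_near_zero (f : cfun (sphere R) R) (e : R) : 0 < e ->
  \forall n \near \oo, forall z : R[i],
    `|z| < (4 * n.+1)%:R^-1 -> `|f (Some z) - f (Some 0)| < e.
Proof.
move=> e0.
have /cvgrPdist_lt/(_ e e0) := @cfun_continuous _ _ f (Some 0).
move=> /nbhs_normP[r /= r0 fr].
have [|k _ rk] := @complex_near_infty_ger r^-1; first by rewrite invr_ge0 ltW.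
exists k => // n /rk /= nr z zn; rewrite distrC; apply: fr => /=.
rewrite sub0r normrN; apply: lt_le_trans zn _.
rewrite invf_ple ?posrE ?ltr0n//; apply: le_trans nr _.
by rewrite ler_nat; lia.
Qed.

Lemma cfun_near_infty (f : cfun (sphere R) R) (e : R) : 0 < e ->
  \forall n \near \oo, forall z : R[i],
    (4 * n.+1)%:R < `|z| -> `|f (Some z) - f None| < e.
Proof.
move=> e0.
have /cvgrPdist_lt/(_ e e0)[K [cK _] fK] := @cfun_continuous _ _ f None.
have [k _ Kk] : \forall n \near \oo, K `<=` (fun z : R[i] => `|z| <= n%:R).
  move/compact_near_coveringP : cK => /(_ nat \oo (fun n z => `|z| <= n%:R)).
  apply => z _.
  exists ([set y : R[i] | `|z - y| < 1], [set n | `|z| + 1 <= n%:R]).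
    split; last exact: complex_near_infty_ger.
    by apply/nbhs_normP; exists 1; rewrite /= ?ltr01.
  move=> [y n] /= [zy zn]; apply: le_trans zn; rewrite -lerBlDl.
  apply: le_trans (ltW zy); rewrite distrC; exact: lerB_dist.
exists k => // n /= kn z zn; rewrite distrC; apply: fK; left; exists z => // Kz.
have zk := Kk _ (leqnn k) _ Kz; have := lt_le_trans zn zk.
by rewrite ltr_nat; lia.
Qed.

End sphere_neighbourhoods.
Section uniform_approximation.
Context (R : realType).
Local Notation M := (lfmeasure (sphere R) R).

Lemma vague_eval_mix01 (u : R) (f : cfun (sphere R) R) : 0 <= u -> u <= 1 ->
  vague_eval (zero_infty_mix u) f = u * f (Some 0) + (1 - u) * f None.
Proof. by move=> u0 u1; rewrite vague_eval_mix !ger0_norm// subr_ge0. Qed.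

Lemma vague_eval_mix_continuous (f : cfun (sphere R) R) :
  continuous (fun u : R => vague_eval (zero_infty_mix u) f).
Proof.
move=> u; under eq_fun do rewrite vague_eval_mix.
apply: cvgD; apply: cvgM; try exact: cvg_cst; apply: cvg_norm; first exact: cvg_id.
by apply: cvgB; [exact: cvg_cst|exact: cvg_id].
Qed.

(** Closeness of mu to the mix at v for each single f, locally uniformly in v, gives
    closeness of F mu to F (mix v) uniformly over the compact [0, 1]. The mixes
    themselves are added to the family S so that F (mix v) and F mu are compared to
    the same value F (mix u). *)
Lemma near_mix_uniform (F : M -> R) (S : nat -> R -> set M) :
  continuous F ->
  (forall (u : R) (f : cfun (sphere R) R) (e : R), 0 <= u -> u <= 1 -> 0 < e ->
     \forall v \near u & n \near \oo, forall mu, S n v mu ->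
       `|vague_eval mu f - vague_eval (zero_infty_mix u) f| < e) ->
  forall e : R, 0 < e -> \forall n \near \oo, forall v mu, 0 <= v -> v <= 1 ->
    S n v mu -> `|F mu - F (zero_infty_mix v)| < e.
Proof.
move=> cF SP e e0.
pose close n v := forall mu, S n v mu -> `|F mu - F (zero_infty_mix v)| < e.
suff : \forall n \near \oo, `[0, 1]%classic `<=` close n.
  apply: filterS => n H v mu v0 v1; apply: H.
  by rewrite /= in_itv/= v0 v1.
apply: (compact_near_coveringP _).1; first exact: segment_compact.
move=> u /=; rewrite in_itv/= => /andP[u0 u1].
pose S' (p : R * nat) mu := S p.2 p.1 mu \/ mu = zero_infty_mix p.1.
(* the convergence of all measures of S' to the mix at u, as a filter *)
pose G : set_system M := fun A => filter_prod (nbhs u) \oo [set p | S' p `<=` A].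
have PF : Filter (filter_prod (nbhs u) (\oo : set_system nat)) by exact: filter_prod_filter.
have GF : Filter G.
  split; rewrite /G/=; first by apply: filterS filterT => p _ mu.
    move=> A B GA GB; apply: filterS2 GA GB => p pA pB mu Sm.
    by split; [exact: pA|exact: pB].
  by move=> A B AB; apply: filterS => p pA mu /pA/AB.
have Gu : G --> zero_infty_mix u.
  apply: vague_cvg => f; apply/cvgrPdist_lt => d d0.
  have near_u : filter_prod (nbhs u) (\oo : set_system nat) [set p |
      `|vague_eval (zero_infty_mix p.1) f - vague_eval (zero_infty_mix u) f| < d].
    have H : nbhs u [set v | `|vague_eval (zero_infty_mix v) f -
        vague_eval (zero_infty_mix u) f| < d].
      have /cvgrPdist_lt/(_ d d0) := @vague_eval_mix_continuous f u.
      by apply: filterS => v; rewrite distrC.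
    exact: (@cvg_fst _ _ (nbhs u) (\oo : set_system nat) _ _ H).
  apply: filterS2 (SP u f d u0 u1 d0) near_u => -[v n] /= H1 H2 mu [/H1|->] //.
    by rewrite distrC.
  by rewrite distrC.
have e2 : 0 < e / 2 by rewrite divr_gt0.
have /cvgrPdist_lt/(_ _ e2) near_F := cF (zero_infty_mix u).
have HG : G [set mu | `|F (zero_infty_mix u) - F mu| < e / 2] := Gu _ near_F.
rewrite /G in HG.
suff : filter_prod (nbhs u) (\oo : set_system nat) [set p | close p.2 p.1] by [].
apply: filterS HG => -[v n] /= H mu Sm.
have h1 := H mu (or_introl Sm); have h2 := H (zero_infty_mix v) (or_intror erefl).
move: h1 h2; rewrite /= !ltr_norml; lra.
Qed.

Lemma sum_two_clusters (f : cfun (sphere R) R) n (s : seq R[i]) (e : R) :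
  {in s, forall z, `|z| < (4 * n.+1)%:R^-1 \/ (4 * n.+1)%:R < `|z|} ->
  (forall z : R[i], `|z| < (4 * n.+1)%:R^-1 -> `|f (Some z) - f (Some 0)| < e) ->
  (forall z : R[i], (4 * n.+1)%:R < `|z| -> `|f (Some z) - f None| < e) ->
  let m := count (fun z => `|z| < (4 * n.+1)%:R^-1) s in
  `|\sum_(z <- s) f (Some z) -
    (m%:R * f (Some 0) + ((size s)%:R - m%:R) * f None)| <= (size s)%:R * e.
Proof.
move=> + f0 foo; elim: s => [|z s IHs] sP /=.
  by rewrite big_nil !mul0r subr0 !mul0r !addr0 subr0 normr0.
have /IHs /= : {in s, forall z, `|z| < (4 * n.+1)%:R^-1 \/ (4 * n.+1)%:R < `|z|}.
  by move=> x xs; apply: sP; rewrite inE xs orbT.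
set m := count _ _; rewrite big_cons -[(size s).+1%:R]natr1 natrD.
have [zd|nzd] := boolP (`|z| < _).
  have := f0 z zd.
  rewrite /= !ltr_norml !ler_norml; lra.
have := foo z _; case: (sP z (mem_head _ _)) => [|zd /(_ zd)]; first by rewrite (negbTE nzd).
rewrite /= !ltr_norml !ler_norml; lra.
Qed.

(** The proportion v is relative to n, not to the number of roots: a degree below n
    removes up to h / n of the mass near infinity. *)
Definition clustered (h n : nat) (v : R) : set M := [set mu |
  exists s : seq R[i], [/\ mu = root_measure n s,
    {in s, forall z, `|z| < (4 * n.+1)%:R^-1 \/ (4 * n.+1)%:R < `|z|},
    v = (count (fun z => `|z| < (4 * n.+1)%:R^-1) s)%:R / n%:R,
    (size s <= n)%N & (n <= size s + h)%N]].

Lemma clustered_near_mix h (u : R) (f : cfun (sphere R) R) (e : R) :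
  0 <= u -> u <= 1 -> 0 < e ->
  \forall v \near u & n \near \oo, forall mu, clustered h n v mu ->
    `|vague_eval mu f - vague_eval (zero_infty_mix u) f| < e.
Proof.
move=> u0 u1 e0; have e4 : 0 < e / 4 by rewrite divr_gt0.
set a := f (Some 0); set b := f None; pose D := `|a| + `|b| + 1.
have D0 : 0 < D by rewrite ltr_wpDl.
exists ([set v | `|u - v| < e / 4 / D], [set n | [/\ (0 < n)%N,
    h%:R * `|b| / (e / 4) <= n%:R,
    forall z : R[i], `|z| < (4 * n.+1)%:R^-1 -> `|f (Some z) - f (Some 0)| < e / 4 &
    forall z : R[i], (4 * n.+1)%:R < `|z| -> `|f (Some z) - f None| < e / 4]]).
  split => /=; first by apply/nbhs_normP; exists (e / 4 / D); rewrite //= divr_gt0.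
  near=> n; split; near: n.
  - exact: nbhs_infty_gt.
  - exact: nbhs_infty_ger.
  - exact: cfun_near_zero.
  - exact: cfun_near_infty.
move=> [v n] /= [uv [n0 hn f0 foo]] _ [s [-> sep vE sn ns]].
have := sum_two_clusters sep f0 foo; rewrite vague_eval_root vague_eval_mix01// /=.
move: vE; set m := count _ _; set t := size s in sn ns *; set S := \sum_(_ <- _) _.
rewrite -/a -/b => vE HS.
have n0' : 0 < n%:R :> R by rewrite ltr0n.
have mE : m%:R = n%:R * v by rewrite vE mulrC divfK ?gt_eqF.
rewrite -(ltr_pM2l n0') -{1}(ger0_norm (ltW n0')) -normrM mulrBr mulrA divff ?gt_eqF// mul1r.
have -> : S - n%:R * (u * a + (1 - u) * b) =
    (S - (m%:R * a + (t%:R - m%:R) * b)) + (n%:R * ((v - u) * (a - b)) - (n%:R - t%:R) * b).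
  by rewrite mE; ring.
apply: le_lt_trans (ler_normD _ _) _.
apply: le_lt_trans (lerD HS (ler_normB _ _)) _; rewrite !normrM (gtr0_norm n0').
have tn : t%:R <= n%:R :> R by rewrite ler_nat.
have nt : n%:R - t%:R <= h%:R :> R by rewrite lerBlDl -natrD ler_nat.
have h1 : t%:R * (e / 4) <= n%:R * (e / 4) by rewrite ler_wpM2r// ltW.
have h2 : `|v - u| * `|a - b| <= e / 4.
  apply: (@le_trans _ _ (e / 4 / D * D)); last by rewrite divfK ?gt_eqF.
  apply: ler_pM => //; first by rewrite distrC ltW.
  by apply: le_trans (ler_normB _ _) _; rewrite /D lerDl.
have {}h2 : n%:R * (`|v - u| * `|a - b|) <= n%:R * (e / 4) by rewrite ler_wpM2l// ltW.
have h3 : `|n%:R - t%:R| * `|b| <= n%:R * (e / 4).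
  rewrite ger0_norm ?subr_ge0//; apply: (@le_trans _ _ (h%:R * `|b|)).
    by rewrite ler_wpM2r.
  by rewrite -ler_pdivrMr.
have : 0 < n%:R * e by rewrite mulr_gt0.
lra.
Unshelve. all: by end_near. Qed.

Lemma near_mix_near_mix (u : R) (f : cfun (sphere R) R) (e : R) :
  0 <= u -> u <= 1 -> 0 < e ->
  \forall v \near u & n \near \oo, forall mu,
    (exists2 x, mu = zero_infty_mix x & `|x - v| <= n%:R^-1) ->
    `|vague_eval mu f - vague_eval (zero_infty_mix u) f| < e.
Proof.
move=> u0 u1 e0.
have /cvgrPdist_lt/(_ e e0)/nbhs_normP[r /= r0 fr] := @vague_eval_mix_continuous f u.
have r2 : 0 < r / 2 by rewrite divr_gt0.
exists ([set v | `|u - v| < r / 2], [set n | (r / 2)^-1 < n%:R]).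
  split => /=; last exact: nbhs_infty_gtr.
  by apply/nbhs_normP; exists (r / 2).
move=> [v n] /= [uv rn] _ [x -> xv]; rewrite distrC; apply: fr => /=.
have n0 : 0 < n%:R :> R by apply: lt_trans rn; rewrite invr_gt0.
move: rn; rewrite invf_plt ?posrE// => rn.
move: uv xv; rewrite !ltr_norml !ler_norml; lra.
Qed.

End uniform_approximation.

(** * Exceedance probabilities of one coefficient *)

Section exceedance.
Context (R : realType).

(** Doubly exponential scales: log|z| doubles from one scale to the next, so slow
    variation makes consecutive exceedance probabilities comparable, while the
    consecutive thresholds differ by the factor exp (2 ^ j). *)
Definition exceed (j : nat) : set (borel R[i]) :=
  [set z | expR (2 ^+ j) < Normc.normc z].

Lemma norm_complexE (z : R[i]) : `|z| = (Normc.normc z)%:C%C.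
Proof. by case: z. Qed.

Lemma measurable_exceed j : measurable (exceed j).
Proof.
apply: sub_sigma_algebra; rewrite openE => z /= zj.
apply/nbhs_normP; exists (Normc.normc z - expR (2 ^+ j))%:C%C.
  by rewrite /= ltcR subr_gt0.
move=> y /= zy; rewrite /exceed/=.
have := le_lt_trans (lerB_dist z y) zy.
by rewrite !norm_complexE -rmorphB/= ltcR ltrD2l ltrN2.
Qed.

Lemma subset_exceed i j : (i <= j)%N -> exceed j `<=` exceed i.
Proof.
move=> ij z; apply: le_lt_trans; rewrite ler_expR.
by rewrite -!natrX ler_nat leq_exp2l.
Qed.

Lemma bigcap_exceed : \bigcap_j exceed j = set0.
Proof.
apply/seteqP; split => // z /= zj.
have [k _ zk] : \forall k \near \oo, Normc.normc z <= k%:R := nbhs_infty_ger _.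
have := lt_le_trans (zj k I) (zk k (leqnn _)); apply/negP.
rewrite -leNgt; apply: le_trans (expR_ge1Dx _).
by rewrite -[leLHS]add0r lerD// -natrX ler_nat ltnW// ltn_expl.
Qed.

End exceedance.
Arguments exceed {R} j.

Section scale_tail_sequence.
Context d (T : measurableType d) (R : realType) (P : probability T R).
Local Notation pr A := (fine (P A)).
Context (X : {RV P >-> borel R[i]}).
Context (X_slow : slowly_varying (log_tail X)).

Definition scale_tail (j : nat) : R := pr (X @^-1` exceed j).

Lemma measurable_preim (Y : {RV P >-> borel R[i]}) A :
  measurable A -> measurable (Y @^-1` A).
Proof. by move=> mA; rewrite -[X in measurable X]setTI; exact: measurable_funPT. Qed.

Lemma measurable_preim_exceed (Y : {RV P >-> borel R[i]}) j :
  measurable (Y @^-1` exceed j).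
Proof. by apply: measurable_preim; exact: measurable_exceed. Qed.

Lemma scale_tailE j : scale_tail j = log_tail X (2 ^+ j).
Proof.
rewrite /scale_tail /log_tail; congr (fine (P _)); apply/seteqP.
have [pos neg] : (forall r : R, 0 < r -> (((2 ^+ j)%:E < lne r%:E)%E = (expR (2 ^+ j) < r))) /\
    ((2 ^+ j)%:E < lne (0 : R)%:E)%E = false.
  split; first by move=> r r0; rewrite lne_EFin// lte_fin -{2}(lnK r0) ltr_expR.
  by rewrite le0_lneNy// ltNge leNye.
split => w h.
  have X0 : 0 < Normc.normc (X w) by apply: le_lt_trans h; exact: expR_ge0.
  by have := pos _ X0; rewrite /mkset => ->.
have [X0|X0] := ltP 0 (Normc.normc (X w)).
  by move: h; have := pos _ X0; rewrite /mkset => ->.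
have X00 : Normc.normc (X w) = 0.
  by apply/eqP; rewrite eq_le X0; case: (X w) => a b /=; exact: sqrtr_ge0.
by move: h; rewrite /mkset X00 neg.
Qed.

Lemma scale_tail_le1 j : scale_tail j <= 1.
Proof.
by rewrite -lee_fin -fine_probabilityE ?probability_le1//; exact: measurable_preim_exceed.
Qed.

Lemma scale_tail_noninc j : scale_tail j.+1 <= scale_tail j.
Proof.
have m i : measurable (X @^-1` exceed i) by exact: measurable_preim_exceed.
rewrite -lee_fin -!fine_probabilityE//; apply: le_measure; rewrite ?inE//.
by move=> w; exact: subset_exceed.
Qed.

Lemma scale_tail_cvg0 : scale_tail @ \oo --> 0.
Proof.
have m i : measurable (X @^-1` exceed i) by exact: measurable_preim_exceed.
have cap0 : \bigcap_j (X @^-1` exceed j) = set0.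
  by rewrite -preimage_bigcap bigcap_exceed preimage_set0.
have := @nonincreasing_cvg_mu _ _ _ P (fun j => X @^-1` exceed j).
rewrite cap0 measure0 => /(_ _ m measurable0) H.
have {H} : P (X @^-1` exceed j) @[j --> \oo] --> 0%:E.
  apply: H; first by rewrite (le_lt_trans (probability_le1 _ _))// ltry.
  by move=> i j ij; apply/subsetPset => w; exact: subset_exceed.
by move=> /fine_cvgP[].
Qed.

Lemma scale_tail_ratio (e : R) : 0 < e ->
  \forall j \near \oo, `|1 - scale_tail j.+1 / scale_tail j| < e.
Proof.
move=> e0; have /cvgrPdist_lt/(_ e e0)[M [_ HM]] := X_slow (ltr0Sn R 1).
apply: filterS (nbhs_infty_gtr M) => j Mj; rewrite !scale_tailE exprS.
apply: HM; apply: lt_trans Mj _; rewrite -natrX ltr_nat; exact: ltn_expl.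
Qed.

Lemma scale_tail_ge0 j : 0 <= scale_tail j.
Proof. exact: fine_ge0. Qed.

(** If the tail vanished somewhere it would vanish from there on, and the ratios
    x / 0 = 0 would not tend to 1. *)
Lemma scale_tail_gt0 j : 0 < scale_tail j.
Proof.
have [k _ Hk] := scale_tail_ratio ltr01.
have : 0 < scale_tail (maxn j k).+1.
  rewrite lt_neqAle scale_tail_ge0 andbT eq_sym; apply/eqP => t0.
  have := Hk (maxn j k) (leq_maxr _ _).
  by rewrite /= t0 mul0r subr0 normr1 ltxx.
move/lt_le_trans; apply.
have /nonincreasing_seqP := scale_tail_noninc; apply.
by rewrite (leq_trans (leq_maxl j k)).
Qed.

Lemma scale_tail_slow (e : R) : 0 < e ->
  \forall j \near \oo, scale_tail j <= (1 + e) * scale_tail j.+1.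
Proof.
move=> e0; have e1 : 0 < 1 + e by lra.
have : 0 < e / (1 + e) by rewrite divr_gt0.
move=> /scale_tail_ratio; apply: filterS => j.
have := scale_tail_gt0 j; have := scale_tail_gt0 j.+1; move: (scale_tail j.+1) (scale_tail j) => x y x0 y0.
rewrite ltr_norml => /andP[_].
have -> : e / (1 + e) = 1 - (1 + e)^-1 by field; rewrite gt_eqF.
rewrite ltrD2l ltrN2 ltr_pdivlMr// mulrC ltr_pdivrMr// mulrC => /ltW; lra.
Qed.

End scale_tail_sequence.

(** * The events on which one coefficient dominates *)

Section dominant_events.
Context d (T : measurableType d) (R : realType) (P : probability T R).
Local Notation pr A := (fine (P A)).
Context (xi : nat -> {RV P >-> borel R[i]}).
Context (xi_indep : independent_RVs xi) (xi_ident : identically_distributed xi).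
Local Notation a := (scale_tail (xi 0)).

Definition coordinate_event (s : seq nat) (B : nat -> set (borel R[i])) : set T :=
  \big[setI/setT]_(k <- s) (xi k @^-1` B k).

Lemma coordinate_eventP s B w :
  coordinate_event s B w <-> forall k, k \in s -> B k (xi k w).
Proof.
rewrite /coordinate_event; elim: s => [|k s IHs]; first by rewrite big_nil; split.
rewrite big_cons; split.
  move=> [Bk /IHs Bs] i; rewrite inE => /orP[/eqP ->//|]; exact: Bs.
move=> H; split; first by apply: H; rewrite mem_head.
by apply/IHs => i si; apply: H; rewrite inE si orbT.
Qed.

Lemma measurable_coordinate_event s B :
  (forall k, measurable (B k)) -> measurable (coordinate_event s B).
Proof.
by move=> mB; apply: bigsetI_measurable => k _; exact: measurable_preim.
Qed.

Lemma pr_coordinate_event s B : uniq s -> (forall k, measurable (B k)) ->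
  pr (coordinate_event s B) = \prod_(k <- s) pr (xi 0 @^-1` B k).
Proof.
move=> us mB; rewrite /coordinate_event (xi_indep us mB).
rewrite (eq_bigr (fun k => (pr (xi 0 @^-1` B k))%:E)) ?prodEFin// => k _.
by rewrite -fine_probabilityE; [exact: (xi_ident k (mB k))|exact: measurable_preim].
Qed.

(** For p = (m, j): the m-th coefficient alone dominates, with a modulus between
    exp (2 ^ j.+1) and exp (2 ^ j.+2) against at most exp (2 ^ j) for the others.
    Fixing the scale j makes the event a rectangle, so that independence yields its
    probability, visibly the same for all m, without conditioning. *)
Definition dominant_event (n : nat) (p : nat * nat) : set T :=
  coordinate_event (iota 0 n.+1) (fun k =>
    if k == p.1 then exceed p.2.+1 `\` exceed p.2.+2 else ~` exceed p.2).

Lemma measurable_dominant_event n p : measurable (dominant_event n p).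
Proof.
apply: measurable_coordinate_event => k; case: ifP => _.
  by apply: measurableD; exact: measurable_exceed.
by apply: measurableC; exact: measurable_exceed.
Qed.

Lemma pr_exceedC j : pr (xi 0 @^-1` (~` exceed j)) = 1 - a j.
Proof.
have m : measurable (xi 0 @^-1` exceed j) by exact: measurable_preim_exceed.
rewrite preimage_setC probability_setC//.
by rewrite fineB ?fin_num_measure.
Qed.

Lemma pr_dominant_event n m j : (m <= n)%N ->
  pr (dominant_event n (m, j)) = (a j.+1 - a j.+2) * (1 - a j) ^+ n.
Proof.
move=> mn; have mE i : measurable (@exceed R i) by exact: measurable_exceed.
rewrite pr_coordinate_event ?iota_uniq//; last first.
  by move=> k; case: ifP => _; [exact: measurableD|exact: measurableC].
rewrite (bigD1_seq m) ?iota_uniq ?mem_iota//= eqxx; congr (_ * _).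
  have -> : xi 0 @^-1` (exceed j.+1 `\` exceed j.+2) =
    (xi 0 @^-1` exceed j.+1) `\` (xi 0 @^-1` exceed j.+2) by [].
  rewrite measureD ?setIidr.
  - rewrite fineB ?fin_num_measure//; exact: measurable_preim.
  - by move=> w; exact: subset_exceed.
  - exact: measurable_preim.
  - exact: measurable_preim.
  - by rewrite (le_lt_trans (probability_le1 _ _)) ?ltry//; exact: measurable_preim.
rewrite (eq_bigr (fun=> 1 - a j)); last first.
  by move=> k /negbTE ->; exact: pr_exceedC.
rewrite big_const_seq iter_mulr_1; congr (_ ^+ _).
have := count_predC (pred1 m) (iota 0 n.+1).
rewrite size_iota count_uniq_mem ?iota_uniq// mem_iota/= ltnS mn add1n.
by move=> -[].
Qed.

(** Two coefficients cannot both dominate, as each would exceed the other; and the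
    dominant one lies on a single scale. *)
Lemma dominant_event_disjoint n p q w : (p.1 <= n)%N -> (q.1 <= n)%N ->
  dominant_event n p w -> dominant_event n q w -> p = q.
Proof.
case: p q => [m j] [m' j'] /= mn mn' /coordinate_eventP H /coordinate_eventP H'.
have := H m; have := H' m'; have := H m'; have := H' m.
rewrite !mem_iota !add0n !ltnS mn mn' !eqxx /=.
have up i i' z : @exceed R i z -> ~ exceed i' z -> (i < i')%N.
  by move=> zi zi'; rewrite ltnNge; apply/negP => /subset_exceed/(_ z zi).
have [<-|mm'] := eqVneq m m'.
  move=> /(_ isT)[A1 A2] /(_ isT)[A3 A4] _ _; congr pair.
  have := up _ _ _ A1 A4; have := up _ _ _ A3 A2; lia.
move=> /(_ isT) A1 /(_ isT) A2 /(_ isT)[A3 _] /(_ isT)[A4 _].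
by have := up _ _ _ A4 A1; have := up _ _ _ A3 A2; lia.
Qed.

(** The ratio exp (2 ^ j) >= exp ((n + 1)^2) of the dominant coefficient to the others
    is at least (4 (n + 1))^(n+1). The second event, that one of the last h + 1
    coefficients is large, keeps the degree at least n - h, so that at most h roots
    are missing. *)
Lemma dominant_event_clustered n h j0 m j w : (12 <= n)%N -> (h <= n)%N -> (m <= n)%N ->
  (n.+1 ^ 2 <= 2 ^ j0)%N -> (j0 <= j)%N ->
  dominant_event n (m, j) w ->
  ~ coordinate_event (iota (n - h) h.+1) (fun=> ~` exceed 0) w ->
  clustered h n (m%:R / n%:R)
    (root_measure n (complex_roots (\poly_(k < n.+1) (xi k w : R[i])))).
Proof.
move=> n12 hn mn nj0 j0j /coordinate_eventP dom high.
set p := \poly_(k < n.+1) _.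
have pk k : (k <= n)%N -> p`_k = xi k w by move=> kn; rewrite coef_poly ltnS kn.
have big0 i z : @exceed R i z -> z != 0.
  move=> zi; apply/eqP => z0; move: zi; rewrite z0 /exceed/=.
  by rewrite expr0n/= addr0 sqrtr0 ltNge expR_ge0.
have pm : (expR (2 ^+ j.+1) < Normc.normc (p`_m)).
  have := dom m; rewrite mem_iota add0n ltnS mn eqxx => /(_ isT)[+ _].
  by rewrite pk.
have pm0 : p`_m != 0 by apply: big0 (_ : exceed j.+1 p`_m).
have pk_small k : (k <= n)%N -> k != m ->
    (4 * n.+1)%:R ^+ n.+1 * `|p`_k| < `|p`_m|.
  move=> kn km; have := dom k; rewrite mem_iota add0n ltnS kn (negbTE km) => /(_ isT).
  rewrite /exceed/= => /negP; rewrite -leNgt -pk// => pkj.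
  rewrite !norm_complexE -(rmorph_nat (real_complex R)) -rmorphXn -rmorphM ltcR.
  apply: le_lt_trans pm.
  have -> : expR (2 ^+ j.+1) = expR (2 ^+ j) * expR (2 ^+ j) :> R.
    by rewrite exprS mulr_natl mulr2n expRD.
  apply: ler_pM pkj; rewrite ?exprn_ge0//.
    by case: (p`_k) => ? ?; exact: sqrtr_ge0.
  apply: (@le_trans _ _ (expR (n.+1%:R ^+ 2))); last first.
    rewrite ler_expR -!natrX ler_nat (leq_trans nj0)// leq_exp2l//.
  rewrite expr2 mulrC expRM_natl lerXn2r ?nnegrE ?expR_ge0//.
  (* exp x >= 4 x for x >= 13, from exp x = exp (x / 2)^2 >= (1 + x / 2)^2 *)
  have -> : expR (n.+1%:R : R) = expR (n.+1%:R / 2) * expR (n.+1%:R / 2).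
    by rewrite -expRD -splitr.
  have h1 := expR_ge1Dx (n.+1%:R / 2 : R).
  have N13 : 13%:R <= n.+1%:R :> R by rewrite ler_nat.
  apply: (@le_trans _ _ ((1 + n.+1%:R / 2) * (1 + n.+1%:R / 2))).
    rewrite natrM; move: N13; move: (n.+1%:R) => N N13.
    have N0 : 0 <= N by lra.
    have := ler_wpM2r N0 N13; lra.
  by apply: ler_pM => //; rewrite addr_ge0// divr_ge0.
have p0 : p != 0 by apply: contraNneq pm0 => ->; rewrite coef0.
have sp : (size p <= n.+1)%N := size_poly _ _.
have [sep cnt _ ss] := dominant_coef_roots mn sp (complex_rootsP p0) pm0 pk_small.
exists (complex_roots p); split => //.
- by rewrite cnt.
- by rewrite ss -subn1 leq_subLR add1n.
- have [k kn k0] : exists2 k, (n - h <= k <= n)%N & p`_k != 0.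
    apply: contrapT => nok; apply: high; apply/coordinate_eventP => k.
    rewrite mem_iota => /andP[hk kn] /= k1; apply: nok.
    have kn' : (k <= n)%N by lia.
    by exists k; [rewrite hk|rewrite pk//; exact: big0 k1].
  have : (k < size p)%N.
    by rewrite ltnNge; apply: contra k0 => ?; rewrite nth_default.
  rewrite ss; move: (size p) => t kt.
  by move: kn kt => /andP[]; clear; lia.
Qed.

Lemma pr_high_small n h : (h <= n)%N ->
  pr (coordinate_event (iota (n - h) h.+1) (fun=> ~` exceed 0)) = (1 - a 0) ^+ h.+1.
Proof.
move=> hn; rewrite pr_coordinate_event ?iota_uniq//; last first.
  by move=> _; apply: measurableC; exact: measurable_exceed.
by rewrite big_const_seq iter_mulr_1 count_predT size_iota pr_exceedC.
Qed.

End dominant_events.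

(** * Comparison with the uniform variable *)

Section uniform_cells.
Context (R : realType) d' (T' : measurableType d') (Q : probability T' R).
Context (U : {RV Q >-> R}).
Context (U_unif : forall A : set R, measurable A ->
  distribution Q U A = uniform_prob (@ltr01 R) A).

Definition cell (N m : nat) : set R := `[m%:R / N%:R, m.+1%:R / N%:R[%classic.

Lemma pr_cell N m : (m < N)%N -> fine (Q (U @^-1` cell N m)) = N%:R^-1.
Proof.
move=> mN; have N0 : 0 < N%:R :> R by rewrite ltr0n (leq_ltn_trans _ mN).
have := U_unif (measurable_itv `[m%:R / N%:R, m.+1%:R / N%:R[).
rewrite /distribution /pushforward -/(cell N m) => ->.
rewrite /uniform_prob (eq_integral (fun=> 1%:E)); last first.
  move=> x; rewrite inE /cell/= in_itv/= => /andP[h1 h2]; rewrite /uniform_pdf subr0 invr1.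
  have x0 : 0 <= x by apply: le_trans h1; rewrite divr_ge0.
  have x1 : x <= 1.
    by apply: le_trans (ltW h2) _; rewrite ler_pdivrMr// mul1r ler_nat.
  by rewrite x0 x1.
rewrite integral_cst; last exact: measurable_itv.
rewrite mul1e [X in fine X](lebesgue_measure_itv `[_, _[) /= lte_fin.
have -> : m%:R / N%:R < m.+1%:R / N%:R :> R by rewrite ltr_pM2r ?invr_gt0// ltr_nat.
by rewrite -EFinB/= -mulrBl -natrB// subSnn mul1r.
Qed.

Lemma cell_disjoint N m m' x : (0 < N)%N -> cell N m x -> cell N m' x -> m = m'.
Proof.
move=> N0; rewrite /cell/= !in_itv/= => /andP[h1 h2] /andP[h3 h4].
have h5 := le_lt_trans h1 h4; have h6 := le_lt_trans h3 h2.
move: h5 h6; rewrite !ltr_pM2r ?invr_gt0 ?ltr0n// !ltr_nat; lia.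
Qed.

Lemma cell_near n m x : (0 < n)%N -> (m <= n)%N -> cell n.+1 m x ->
  `|x - m%:R / n%:R| <= n%:R^-1.
Proof.
move=> n0 mn; rewrite /cell/= in_itv/= => /andP[h1 h2].
have n0' : 0 < n%:R :> R by rewrite ltr0n.
have N0 : 0 < n.+1%:R :> R by rewrite ltr0n.
rewrite ler_norml; apply/andP; split.
  rewrite lerBrDr addrC; apply: le_trans h1.
  rewrite -{2}[n%:R^-1]mul1r -mulrBl ler_pdivrMr// mulrAC ler_pdivlMr//.
  have : m%:R <= n%:R :> R by rewrite ler_nat.
  by rewrite -natr1; lra.
rewrite lerBlDr -{1}[n%:R^-1]mul1r -mulrDl nat1r; apply: le_trans (ltW h2) _.
by rewrite ler_pM2l ?ltr0n// lef_pV2 ?posrE// ler_nat.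
Qed.

End uniform_cells.

Section limit.
Context (R : realType) (d : measure_display) (T : measurableType d) (P : probability T R).
Context (xi : nat -> {RV P >-> borel R[i]}).
Context (xi_indep : independent_RVs xi) (xi_ident : identically_distributed xi).
Context (xi_slow : slowly_varying (log_tail (xi 0%N))).
Context (d' : measure_display) (T' : measurableType d') (Q : probability T' R).
Context (U : {RV Q >-> R}).
Context (U_unif : forall A : set R, measurable A ->
  distribution Q U A = uniform_prob (@ltr01 R) A).
Local Notation mu_ n w :=
  (root_measure n (complex_roots (\poly_(k < n.+1) (xi k w : R[i])))).

(** Both expectations are close to the average of F (mix (m / n)) over 0 <= m <= n:
    the first because each m is the dominant index with nearly the probability
    1 / (n + 1), the second because U falls in the m-th cell with exactly this
    probability. Comparing the two averages also takes the place of a Riemann sum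
    for the integral of u |-> F (mix u). *)
Lemma expectations_close (F : lfmeasure (sphere R) R -> R) (C : R) :
  continuous F -> (forall m, `|F m| <= C) ->
  forall e, 0 < e -> \forall n \near \oo, exists x y : R,
    [/\ ('E_P[fun w => F (mu_ n w)] = x%:E)%E,
        ('E_Q[fun w => F (zero_infty_mix (U w))] = y%:E)%E & `|x - y| <= e].
Proof.
move=> cF FC e e0.
have C0 : 0 <= C by apply: le_trans (FC (zero_infty_mix 0)).
have e8 : 0 < e / 8 by rewrite divr_gt0.
have C1 : 0 < C + 1 by rewrite ltr_pwDr.
pose eta := e / 8 / (C + 1).
have eta0 : 0 < eta by rewrite divr_gt0.
have Ceta : C * eta <= e / 8.
  by rewrite /eta mulrCA ler_piMr ?(ltW e8)// ler_pdivrMr// mul1r lerDl.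
set a := scale_tail (xi 0).
have a_gt0 := scale_tail_gt0 xi_slow; have a_le1 := @scale_tail_le1 _ _ _ _ (xi 0).
(* h bounds the number of roots lost to vanishing leading coefficients *)
have [h ha] : exists h, (1 - a 0) ^+ h.+1 <= eta.
  have a01 : `|1 - a 0| < 1.
    by rewrite ger0_norm ?subr_ge0 ?a_le1// ltrBlDr ltrDl a_gt0.
  have /cvgrPdist_lt/(_ eta eta0)[h _ H] := cvg_expr a01.
  exists h; have := H h.+1 (leqnSn h); rewrite /= sub0r normrN => /ltW.
  exact: le_trans (ler_norm _).
have dom := dominant_prob_near1 a_gt0 a_le1 (@scale_tail_noninc _ _ _ _ (xi 0))
  (scale_tail_slow xi_slow) (@scale_tail_cvg0 _ _ _ _ (xi 0)) eta0.
have close1 := near_mix_uniform cF (@clustered_near_mix R h) e8.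
have close2 := near_mix_uniform cF (@near_mix_near_mix R) e8.
near=> n.
have n12 : (12 <= n)%N by near: n; exact: nbhs_infty_ge.
have n0 : (0 < n)%N by rewrite (leq_trans _ n12).
have hn : (h <= n)%N by near: n; exact: nbhs_infty_ge.
have [j0 [L [nj0 q_large]]] : exists j0 L, (n.+1 ^ 2 <= 2 ^ j0)%N /\
  1 - eta <= n.+1%:R * \sum_(j0 <= j < L) (a j.+1 - a j.+2) * (1 - a j) ^+ n.
  by near: n.
have close1n : forall v mu, 0 <= v -> v <= 1 -> clustered h n v mu ->
  `|F mu - F (zero_infty_mix v)| < e / 8 by near: n.
have close2n : forall v mu, 0 <= v -> v <= 1 ->
  (exists2 x : R, mu = zero_infty_mix x & `|x - v| <= n%:R^-1) ->
  `|F mu - F (zero_infty_mix v)| < e / 8 by near: n.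
pose c m := F (zero_infty_mix (m%:R / n%:R)).
have v01 m : (m <= n)%N -> 0 <= m%:R / n%:R :> R /\ m%:R / n%:R <= 1 :> R.
  by move=> mn; rewrite divr_ge0// ler_pdivrMr ?ltr0n// mul1r ler_nat.
pose q := \sum_(j0 <= j < L) (a j.+1 - a j.+2) * (1 - a j) ^+ n.
pose r := [seq (m, j) | m <- iota 0 n.+1, j <- index_iota j0 L].
have rP p : p \in r -> (p.1 <= n)%N /\ (j0 <= p.2)%N.
  case/allpairsP => -[m j] []; rewrite mem_iota mem_index_iota add0n ltnS.
  by move=> mn /andP[j0j _] -> /=.
have ur : uniq r.
  by apply: allpairs_uniq; rewrite ?iota_uniq// => -[? ?] [? ?].
have sumr (f : nat -> R) :
    \sum_(p <- r) f p.1 * fine (P (dominant_event xi n p)) =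
    \sum_(m <- iota 0 n.+1) f m * q.
  rewrite big_allpairs_dep; apply: eq_big_seq => m.
  rewrite mem_iota add0n ltnS => mn /=; rewrite /q mulr_sumr; apply: eq_bigr => j _.
  by rewrite pr_dominant_event.
have dis p p' w : p \in r -> p' \in r -> dominant_event xi n p w ->
    dominant_event xi n p' w -> p = p'.
  by move=> /rP[pn _] /rP[pn' _]; exact: dominant_event_disjoint.
have mdom p : measurable (dominant_event xi n p) by exact: measurable_dominant_event.
have mhigh : measurable (coordinate_event xi (iota (n - h) h.+1) (fun=> ~` exceed 0)).
  by apply: measurable_coordinate_event => _; apply: measurableC; exact: measurable_exceed.
have pr_sum : \sum_(p <- r) fine (P (dominant_event xi n p)) = n.+1%:R * q.
  rewrite (eq_bigr (fun p => 1 * fine (P (dominant_event xi n p)))); last first.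
    by move=> p _; rewrite mul1r.
  rewrite (sumr (fun=> 1)) mul1r big_const_seq count_predT size_iota iter_addr_0.
  by rewrite mulr_natl.
have Nq1 : n.+1%:R * q <= 1 by rewrite -pr_sum; exact: sum_pr_le1.
have [|x Ex xc] := expectation_sandwich P ur mdom dis mhigh (ltW e8)
  (g := fun w => F (mu_ n w)) (c := fun p => c p.1)
  (fun w => FC _) (fun p => FC _).
  move=> [m j] w /rP[/= mn j0j] domw nhigh; apply/ltW.
  have [v0 v1] := v01 m mn.
  by apply: close1n => //; exact: dominant_event_clustered j0j domw nhigh.
have mcell m : measurable (U @^-1` cell n.+1 m : set T').
  rewrite -[X in measurable X]setTI.
  by apply: (measurable_funPT U measurableT); exact: measurable_itv.
have [|y Ey yc] := expectation_sandwich Q (iota_uniq 0 n.+1) mcell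
  (fun m m' w _ _ => @cell_disjoint R n.+1 m m' (U w) isT) measurable0 (ltW e8)
  (g := fun w => F (zero_infty_mix (U w))) (c := c)
  (fun w => FC _) (fun m => FC _).
  move=> m w; rewrite mem_iota add0n ltnS => mn Um _; apply/ltW.
  have [v0 v1] := v01 m mn.
  by apply: close2n => //; exists (U w) => //; exact: cell_near.
exists x, y; split => //.
move: xc; rewrite sumr pr_sum pr_high_small// => xc.
move: yc; rewrite measure0/= mulr0 addr0.
have -> : \sum_(m <- iota 0 n.+1) fine (Q (U @^-1` cell n.+1 m)) = 1.
  rewrite (eq_big_seq (fun=> n.+1%:R^-1)); last first.
    by move=> m; rewrite mem_iota add0n => mn; exact: pr_cell.
  rewrite big_const_seq count_predT size_iota iter_addr_0 -[LHS]mulr_natl mulfV// pnatr_eq0.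
have -> : \sum_(m <- iota 0 n.+1) c m * fine (Q (U @^-1` cell n.+1 m)) =
    \sum_(m <- iota 0 n.+1) c m * n.+1%:R^-1.
  apply: eq_big_seq => m; rewrite mem_iota add0n => mn; congr (_ * _).
  exact: pr_cell.
rewrite subrr mulr0 addr0 => yc.
have sum_close : `|\sum_(m <- iota 0 n.+1) c m * q -
    \sum_(m <- iota 0 n.+1) c m * n.+1%:R^-1| <= C * eta.
  rewrite -!mulr_suml -mulrBr normrM.
  have cs : `|\sum_(m <- iota 0 n.+1) c m| <= n.+1%:R * C.
    apply: le_trans (ler_norm_sum _ _ _) _.
    apply: (@le_trans _ _ (\sum_(m <- iota 0 n.+1) C)).
      by apply: ler_sum => m _; exact: FC.
    by rewrite big_const_seq count_predT size_iota iter_addr_0 -[leLHS]mulr_natl.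
  apply: le_trans (ler_wpM2r (normr_ge0 _) cs) _.
  rewrite mulrAC mulrC ler_wpM2l//.
  rewrite -{1}[n.+1%:R]ger0_norm// -normrM mulrBr mulfV//.
  by rewrite distrC ger0_norm ?subr_ge0//; move: q_large; rewrite -/q; lra.
have h1 : C * (1 - n.+1%:R * q) <= e / 8.
  apply: le_trans Ceta; rewrite ler_wpM2l//; move: q_large; rewrite -/q; lra.
have h2 : 2 * C * (1 - a 0) ^+ h.+1 <= 2 * (e / 8).
  by rewrite -mulrA ler_wpM2l// (le_trans _ Ceta)// ler_wpM2l.
move: xc yc sum_close; rewrite -/a !ler_norml; lra.
Unshelve. all: by end_near. Qed.

End limit.

Theorem corollary1p6 (R : realType)
    (d : measure_display) (T : measurableType d) (P : probability T R)
    (xi : nat -> {RV P >-> borel R[i]})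
    (xi_indep : independent_RVs xi)
    (xi_ident : identically_distributed xi)
    (xi_nondeg : nondegenerate_RV (xi 0%N))
    (xi_slow : slowly_varying (log_tail (xi 0%N)))
    (d' : measure_display) (T' : measurableType d') (Q : probability T' R)
    (U : {RV Q >-> R})
    (U_unif : forall A : set R, measurable A ->
       distribution Q U A = uniform_prob (@ltr01 R) A) :
  random_measure_cvg P Q
    (fun n w =>
       root_measure n (complex_roots (\poly_(k < n.+1) (xi k w : R[i]))))
    (fun w => zero_infty_mix (U w)).
Proof.
move=> F cF [C FC].
have close := expectations_close xi_indep xi_ident xi_slow U_unif cF FC.
have [n0 _ /(_ n0 (leqnn _)) [_ [y [_ Ey _]]]] := close 1 ltr01.
rewrite -[F \o (fun w => _)]/(fun w => F (zero_infty_mix (U w))) Ey.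
apply/fine_cvgP; split.
  by apply: filterS (close 1 ltr01) => n [x [_ [Ex _ _]]]; rewrite Ex.
apply/cvgrPdist_le => e e0; apply: filterS (close e e0) => n [x [y' [Ex Ey' xy]]].
by move: Ey'; rewrite Ey /= Ex => -[->]; rewrite distrC.
Qed.
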